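(* Let $(X,\mu)$ be a non-atomic probability space with a tree $\mathcal{T}$, let $p>1$, and let $0<f^p\le F$. Let $(\phi_n)_n$ be a sequence of nonnegative, $\mathcal{T}$-good functions on $X$ such that $\int_X\phi_n\,d\mu=f$ and $\int_X\phi_n^p\,d\mu=F$ for all $n$. Then $(\phi_n)_n$ is extremal, that is, $$\lim_{n}\int_X(\mathcal{M}_{\mathcal{T}}\phi_n)^p\,d\mu=F\,\omega_p(f^p/F)^p,$$ if and only if $$\lim_{n}\int_X|\mathcal{M}_{\mathcal{T}}\phi_n-c\,\phi_n|^p\,d\mu=0,\qquad\text{where } c=\omega_p(f^p/F).$$
   Context: Tree: a set $\mathcal{T}$ of measurable subsets of $X$ is called a tree if (i) $X\in\mathcal{T}$ and $\mu(I)>0$ for every $I\in\mathcal{T}$; (ii) to every $I\in\mathcal{T}$ there corresponds a finite or countable subset $C(I)\subseteq\mathcal{T}$ with at least two elements, whose elements are pairwise disjoint subsets of $I$ with $I=\bigcup C(I)$; (iii) $\mathcal{T}=\bigcup_{m\ge0}\mathcal{T}_{(m)}$, where $\mathcal{T}_{(0)}=\{X\}$ and $\mathcal{T}_{(m+1)}=\bigcup_{I\in\mathcal{T}_{(m)}}C(I)$; (iv) $\lim_{m\to\infty}\sup_{I\in\mathcal{T}_{(m)}}\mu(I)=0$. Maximal operator: for $\phi\in L^1(X,\mu)$, $\mathcal{M}_{\mathcal{T}}\phi(x)=\sup\{\frac{1}{\mu(I)}\int_I|\phi|\,d\mu : x\in I\in\mathcal{T}\}$. The function $\omega_p$: $\omega_p:[0,1]\to[1,\frac{p}{p-1}]$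 is the inverse function of $H_p:[1,\frac{p}{p-1}]\to[0,1]$, $H_p(z)=-(p-1)z^p+pz^{p-1}$. The number $F\omega_p(f^p/F)^p$ is the value of the Bellman function $B_p^{\mathcal{T}}(f,F)=\sup\{\int_X(\mathcal{M}_{\mathcal{T}}\phi)^p d\mu:\phi\ge0,\ \int_X\phi\,d\mu=f,\ \int_X\phi^p\,d\mu=F\}$. $\mathcal{T}$-good: for nonnegative $\phi\in L^1(X,\mu)$ and $I\in\mathcal{T}$ let $Av_I(\phi)=\frac{1}{\mu(I)}\int_I\phi\,d\mu$. Then $\phi$ is called $\mathcal{T}$-good if the set $\{x\in X:\mathcal{M}_{\mathcal{T}}\phi(x)>Av_I(\phi)\text{ for all }I\in\mathcal{T}\text{ with }x\in I\}$ has $\mu$-measure zero. *)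

(* Defs.v *)
From HB Require Import structures.
From mathcomp Require Import all_boot all_order all_algebra.
From mathcomp Require Import all_classical all_reals all_analysis.

Set Implicit Arguments.
Unset Strict Implicit.
Unset Printing Implicit Defensive.

Import Order.TTheory GRing.Theory Num.Theory.
Import numFieldNormedType.Exports.

Local Open Scope classical_set_scope.
Local Open Scope ring_scope.
Local Open Scope ereal_scope.

Definition nonatomic (d : measure_display) (X : measurableType d)
    (R : realType) (mu : {measure set X -> \bar R}) : Prop :=
  forall A : set X, measurable A -> 0 < mu A ->
    exists B : set X, [/\ measurable B, B `<=` A, 0 < mu B & mu B < mu A].

Fixpoint generation (X : Type) (C : set X -> set (set X)) (m : nat)
    : set (set X) :=
  if m is k.+1 then \bigcup_(I in generation C k) C I else [set setT].

Record is_tree_with (d : measure_display) (X : measurableType d)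
    (R : realType) (mu : {measure set X -> \bar R})
    (T : set (set X)) (C : set X -> set (set X)) : Prop := IsTreeWith {
  tree_measurable : forall I, T I -> measurable I ;
  tree_setT : T setT ;
  tree_pos : forall I, T I -> 0 < mu I ;
  tree_child_sub : forall I, T I -> C I `<=` T ;
  tree_child_countable : forall I, T I -> countable (C I) ;
  tree_child_two : forall I, T I -> exists J K, [/\ C I J, C I K & J <> K] ;
  tree_child_disjoint : forall I, T I -> trivIset (C I) id ;
  tree_child_cover : forall I, T I -> I = \bigcup_(J in C I) J ;
  tree_generations : T = \bigcup_m generation C m ;
  tree_shrinks :
    ereal_sup [set mu I | I in generation C m] @[m --> \oo] --> 0 }.

Definition is_tree (d : measure_display) (X : measurableType d)
    (R : realType) (mu : {measure set X -> \bar R}) (T : set (set X)) : Prop :=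
  exists C : set X -> set (set X), is_tree_with mu T C.

Definition Av (d : measure_display) (X : measurableType d) (R : realType)
    (mu : {measure set X -> \bar R}) (I : set X) (phi : X -> R) : \bar R :=
  (mu I)^-1 * \int[mu]_(x in I) (phi x)%:E.

(* Extended-real valued: the supremum may be +oo at some points even when phi
   is integrable. *)
Definition maximal (d : measure_display) (X : measurableType d) (R : realType)
    (mu : {measure set X -> \bar R}) (T : set (set X)) (phi : X -> R) (x : X)
    : \bar R :=
  ereal_sup [set Av mu I (fun y => `|phi y|%R) | I in [set I | T I /\ I x]].

(* For a tree T the set below is measurable (T is countable), so negligibility
   says that its measure is 0. *)
Definition good (d : measure_display) (X : measurableType d) (R : realType)
    (mu : {measure set X -> \bar R}) (T : set (set X)) (phi : X -> R) : Prop :=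
  mu.-negligible
    [set x | forall I, T I -> I x -> Av mu I phi < maximal mu T phi x].

Definition Hp (R : realType) (p z : R) : R :=
  (- (p - 1) * z `^ p + p * z `^ (p - 1))%R.

(* The inverse of Hp p restricted to [1, p/(p-1)]; the default value 0 is only
   used outside the image of that interval, which is [0, 1] for 1 < p. *)
Definition omega (R : realType) (p : R) : R -> R :=
  'pinv_(fun=> 0%R) `[1%R, (p / (p - 1))%R]%classic (Hp p).

Definition extremal (d : measure_display) (X : measurableType d)
    (R : realType) (mu : {measure set X -> \bar R}) (T : set (set X))
    (p f F : R) (phi : nat -> X -> R) : Prop :=
  \int[mu]_x (maximal mu T (phi n) x `^ p) @[n --> \oo]
    --> (F * omega p (f `^ p / F) `^ p)%:E.

(* Main.v *)
Require Import Defs.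
From HB Require Import structures.
From mathcomp Require Import all_boot all_order all_algebra.
From mathcomp Require Import all_classical all_reals all_analysis.
From mathcomp Require Import measurable_realfun.
From mathcomp Require Import ring lra.

Set Implicit Arguments.
Unset Strict Implicit.
Unset Printing Implicit Defensive.

Import Order.TTheory GRing.Theory Num.Theory.
Import numFieldNormedType.Exports.

(** Write M for the maximal function of phi, S for the integral of M^p, and
    G(a, b) = a^p + (p - 1) b^p - p a b^(p-1) for the defect in Young's
    inequality, which is nonnegative and vanishes only for a = b.

    The maximal function satisfies a weak-type inequality with constant 1: the
    set {M > l} is a disjoint union of tree elements on which phi has average
    more than l, so l mu{M > l} <= int_{M > l} phi ([maximal_weak_type]).
    Summing over levels l gives the sharp Doob-type inequality
      (p - 1) S + f^p <= p int phi M^(p-1)             ([doob_inequality]).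

    Let c = omega_p(f^p / F), so that f^p = F (p c^(p-1) - (p - 1) c^p), and
    integrate the Young defect of the pair (c phi, M).  The Doob-type
    inequality bounds the cross term from below and everything collapses to
      0 <= int G(c phi, M) <= (p - 1)(c - 1)(c^p F - S).
    In particular S <= c^p F when c > 1, and for an extremal sequence the
    integrated Young defect tends to 0.  The defect controls the distance,
    quantitatively: for every e > 0 there is K with
      |a - b|^p <= e (a^p + b^p) + K G(a, b)           ([powR_dist_le_gap]),
    and S is bounded in terms of p and F alone ([integral_pow_bound]); hence
    int |M - c phi|^p tends to 0.

    Conversely, b^p <= a^p + e b^p + K |a - b|^p ([powR_le_dist]) applied to
    (c phi, M) and (M, c phi) shows that S is close to int (c phi)^p = c^p F
    as soon as int |M - c phi|^p is small. *)

Local Open Scope classical_set_scope.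
Local Open Scope ring_scope.

(** * Young's inequality and its stability *)

Lemma continuous_powR (R : realType) (r x : R) : 0 < x ->
  {for x, continuous (fun z : R => z `^ r)}.
Proof.
move=> x0; apply: differentiable_continuous; apply/derivable1_diffP.
by apply: derivable_powR; rewrite in_itv/= x0.
Qed.

Section young.
Context {R : realType} (p : R).
Hypothesis p_gt1 : 1 < p.
Implicit Types a b : R.

Let p_gt0 : 0 < p. Proof. by rewrite (lt_trans _ p_gt1). Qed.
Let p1_gt0 : 0 < p - 1. Proof. by rewrite subr_gt0. Qed.

Lemma powR_split a : 0 <= a -> a `^ p = a * a `^ (p - 1).
Proof. by move=> a0; rewrite mulr_powRB1. Qed.

Lemma powR_le r a b : 0 < r -> 0 <= a -> a <= b -> a `^ r <= b `^ r.
Proof.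
move=> r0 a0 ab; apply: ge0_ler_powR; rewrite ?nnegrE ?(ltW r0)//.
exact: le_trans ab.
Qed.

(** p times the difference of the two sides in Young's inequality for a and
    b^(p-1). *)
Definition young_gap a b :=
  a `^ p + (p - 1) * b `^ p - p * (a * b `^ (p - 1)).

Lemma young_gapM k a b : 0 <= k -> 0 <= a -> 0 <= b ->
  young_gap (k * a) (k * b) = k `^ p * young_gap a b.
Proof.
move=> k0 a0 b0; rewrite /young_gap !powRM// (powR_split k0); ring.
Qed.

(** For positive a and b, homogeneity reduces to the pairs (t, 1), and writing
    t = expR y the two exponential bounds expR ((p-1) y) >= 1 + (p-1) y and
    expR (-y) > 1 - y combine to the claim; the strictness comes from the
    second one. *)
Lemma young_gap_gt0 a b : 0 <= a -> 0 <= b -> a != b -> 0 < young_gap a b.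
Proof.
move=> a0 b0 ab; case: (eqVneq b 0) => [bE|bn0].
  rewrite /young_gap bE powR0 ?gt_eqF// powR0 ?gt_eqF//.
  rewrite !mulr0 addr0 subr0 powR_gt0//.
  by rewrite lt_neqAle a0 andbT eq_sym -bE.
have {bn0}b_gt0 : 0 < b by rewrite lt_neqAle b0 andbT eq_sym.
case: (eqVneq a 0) => [aE|an0].
  rewrite /young_gap aE powR0 ?gt_eqF// add0r mul0r mulr0 subr0.
  by rewrite mulr_gt0// powR_gt0.
have {an0}a_gt0 : 0 < a by rewrite lt_neqAle a0 andbT eq_sym.
have -> : young_gap a b = young_gap (b * (a / b)) (b * 1).
  by rewrite mulr1 mulrC divfK// gt_eqF.
rewrite young_gapM ?divr_ge0 ?ler01//.
apply: mulr_gt0; first exact: powR_gt0.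
set y := ln (a / b).
have yE : a / b = expR y by rewrite lnK// posrE divr_gt0.
have y0 : y != 0.
  apply: contra_neq ab => y0; move: yE; rewrite y0 expR0 => /divr1_eq//.
rewrite /young_gap powR1 !mulr1 powR_split ?divr_ge0// /powR.
rewrite mulf_eq0 invr_eq0 !gt_eqF//= yE expRK.
have e1 := expR_ge1Dx ((p - 1) * y).
have e2 : 1 - y < expR (- y) by apply: expR_gt1Dx; rewrite oppr_eq0.
have ey := expR_gt0 y.
have e3 : (1 - y) * expR y < 1.
  by rewrite -[ltRHS](expRxMexpNx_1 y) [ltRHS]mulrC ltr_pM2r.
have e4 : expR y * (1 + (p - 1) * y) <= expR y * expR ((p - 1) * y).
  by rewrite ler_pM2l.
have e5 : (p - 1) * ((1 - y) * expR y) < p - 1 by rewrite gtr_pMr.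
lra.
Qed.

Lemma young_gap_ge0 a b : 0 <= a -> 0 <= b -> 0 <= young_gap a b.
Proof.
move=> a0 b0; have [->|ab] := eqVneq a b; last exact/ltW/young_gap_gt0.
by rewrite /young_gap (powR_split b0); lra.
Qed.

(** Discrete form of d(t^p) = p / (p-1) t d(t^(p-1)), with t replaced by the
    larger end point; it is Young's inequality for (b, a) rearranged.  Having
    the exact constant for arbitrarily large steps is what lets the sharp
    inequality be proved by summation over finitely many levels. *)
Lemma powR_step a b : 0 <= a -> 0 <= b ->
  (p - 1) * (b `^ p - a `^ p) <= p * (b * (b `^ (p - 1) - a `^ (p - 1))).
Proof.
move=> a0 b0; have := young_gap_ge0 b0 a0; rewrite /young_gap.
by rewrite (powR_split b0); lra.
Qed.

Lemma young_gap_decrl a a' b : 0 <= a -> a <= a' -> a' <= b ->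
  young_gap a' b <= young_gap a b.
Proof.
move=> a0 aa' a'b.
have a'0 := le_trans a0 aa'; have b0 := le_trans a'0 a'b.
have := young_gap_ge0 a0 a'0; rewrite /young_gap.
have pa'b : a' `^ (p - 1) <= b `^ (p - 1) by exact: powR_le.
have : 0 <= (b `^ (p - 1) - a' `^ (p - 1)) * (a' - a).
  by rewrite mulr_ge0// subr_ge0.
rewrite -(pmulr_rge0 _ p_gt0) (powR_split a'0); nra.
Qed.

Lemma young_gap_decrr a b b' : 0 <= b -> b <= b' -> b' <= a ->
  young_gap a b' <= young_gap a b.
Proof.
move=> b0 bb' b'a.
have b'0 := le_trans b0 bb'; have a0 := le_trans b'0 b'a.
have := powR_step b0 b'0; rewrite /young_gap.
have pbb' : b `^ (p - 1) <= b' `^ (p - 1) by exact: powR_le.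
have : 0 <= (a - b') * (b' `^ (p - 1) - b `^ (p - 1)).
  by rewrite mulr_ge0// subr_ge0.
rewrite -(pmulr_rge0 _ p_gt0); nra.
Qed.

(** If |a - b| is at most e times the larger of a and b, the first term on the
    right is enough.  Otherwise the smaller one is at most s = 1 - e times the
    larger one, c say; the gap only grows as the smaller argument decreases, so
    by homogeneity it is at least c^p times its value at (s, 1) or (1, s),
    which is positive. *)
Lemma powR_dist_le_gap (e : R) : 0 < e ->
  exists2 K : R, 0 <= K & forall a b : R, 0 <= a -> 0 <= b ->
    `|a - b| `^ p <= e * (a `^ p + b `^ p) + K * young_gap a b.
Proof.
wlog e1 : e / (e < 1).
  move=> H e0; have m0 : 0 < Num.min e (1 / 2).
    by rewrite lt_min e0 divr_gt0.
  have /(_ _ m0)[] := H (Num.min e (1 / 2)).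
    by rewrite gt_min; apply/orP; right; lra.
  move=> K K0 HK; exists K => // a b a0 b0.
  apply: le_trans (HK a b a0 b0) _; rewrite lerD2r.
  by rewrite ler_wpM2r ?addr_ge0 ?powR_ge0// ge_min lexx.
move=> e0; pose s := 1 - e.
have s0 : 0 < s by rewrite /s; lra.
have s1 : s < 1 by rewrite /s; lra.
pose d := Num.min (young_gap s 1) (young_gap 1 s).
have d0 : 0 < d.
  by rewrite lt_min !young_gap_gt0 ?ltW// ?(lt_eqF s1)// (gt_eqF s1).
exists d^-1; first by rewrite invr_ge0 ltW.
(* in [small] and [large], c stands for the larger of a and b *)
have small a b c : 0 <= a -> 0 <= b -> `|a - b| <= e * c -> 0 <= c ->
    c `^ p <= a `^ p + b `^ p ->
    `|a - b| `^ p <= e * (a `^ p + b `^ p) + d^-1 * young_gap a b.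
  move=> a0 b0 abe c0 cab.
  have -> : e * (a `^ p + b `^ p) + d^-1 * young_gap a b =
     d^-1 * young_gap a b + e * (a `^ p + b `^ p) by rewrite addrC.
  rewrite -[leLHS]add0r lerD//.
    by rewrite mulr_ge0 ?young_gap_ge0// invr_ge0 ltW.
  apply: le_trans (_ : (e * c) `^ p <= _).
    exact: powR_le.
  rewrite powRM ?(ltW e0)//; apply: ler_pM => //; rewrite ?powR_ge0//.
  by apply: ge1r_powR; rewrite ?e0 ltW.
have large a b c : 0 <= a -> 0 <= b -> 0 <= c -> `|a - b| <= c ->
    c `^ p * d <= young_gap a b ->
    `|a - b| `^ p <= e * (a `^ p + b `^ p) + d^-1 * young_gap a b.
  move=> a0 b0 c0 abc cd; rewrite -[leLHS]add0r lerD//.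
    by rewrite mulr_ge0 ?addr_ge0 ?powR_ge0// ltW.
  apply: le_trans (_ : c `^ p <= _).
    exact: powR_le.
  by rewrite ler_pdivlMl// mulrC.
move=> a b a0 b0; have [ab|/ltW ba] := leP a b.
  have dE : `|a - b| = b - a by rewrite distrC ger0_norm// subr_ge0.
  have [asb|sba] := leP a (s * b).
    apply: (large _ _ b) => //; first by rewrite dE; lra.
    apply: le_trans (_ : b `^ p * young_gap s 1 <= _).
      by rewrite ler_wpM2l ?powR_ge0// ge_min lexx.
    rewrite -young_gapM ?ler01 ?(ltW s0)// mulr1 mulrC young_gap_decrl//.
    by rewrite ler_piMl// ltW.
  apply: (small _ _ b) => //.
    by rewrite dE; move: sba; rewrite /s; lra.
  by rewrite lerDr powR_ge0.
have dE : `|a - b| = a - b by rewrite ger0_norm// subr_ge0.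
have [bsa|sab] := leP b (s * a).
  apply: (large _ _ a) => //; first by rewrite dE; lra.
  apply: le_trans (_ : a `^ p * young_gap 1 s <= _).
    by rewrite ler_wpM2l ?powR_ge0// ge_min lexx orbT.
  rewrite -young_gapM ?ler01 ?(ltW s0)// mulr1 [a * s]mulrC young_gap_decrr//.
  by rewrite ler_piMl// ltW.
apply: (small _ _ a) => //.
  by rewrite dE; move: sab; rewrite /s; lra.
by rewrite lerDl powR_ge0.
Qed.

(** Convexity gives b^p - a^p <= p |a - b| b^(p-1); the product on the right is
    absorbed by e b^p if |a - b| is at most (e / p) b, and otherwise b^(p-1) is
    at most a constant times |a - b|^(p-1). *)
Lemma powR_le_dist (e : R) : 0 < e ->
  exists2 K : R, 0 <= K & forall a b : R, 0 <= a -> 0 <= b ->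
    b `^ p <= a `^ p + e * b `^ p + K * `|a - b| `^ p.
Proof.
move=> e0; pose t := e / p; have t0 : 0 < t by rewrite divr_gt0.
exists (p * (t^-1) `^ (p - 1)).
  by rewrite mulr_ge0 ?powR_ge0// ltW.
move=> a b a0 b0; have := young_gap_ge0 a0 b0; rewrite /young_gap => G.
have step : b `^ p <= a `^ p + p * (`|a - b| * b `^ (p - 1)).
  have : p * ((b - a) * b `^ (p - 1)) <= p * (`|a - b| * b `^ (p - 1)).
    by rewrite ler_pM2l// ler_wpM2r ?powR_ge0// distrC ler_norm.
  by move: G; rewrite (powR_split b0); lra.
have pt : p * t = e by rewrite /t; field; rewrite gt_eqF.
apply: le_trans step _; rewrite -addrA lerD2l.
have [le|lt] := leP `|a - b| (t * b).
  rewrite -[leLHS]addr0 lerD//; last by rewrite !mulr_ge0 ?powR_ge0// ltW.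
  rewrite (powR_split b0) -pt -mulrA ler_pM2l// mulrA ler_wpM2r ?powR_ge0//.
rewrite -[leLHS]add0r lerD ?mulr_ge0 ?powR_ge0 ?(ltW e0)//.
rewrite -mulrA ler_pM2l// powR_split// mulrCA ler_wpM2l//.
rewrite -powRM ?invr_ge0 ?(ltW t0)//; apply: powR_le => //.
by rewrite ler_pdivlMl// ltW.
Qed.

(** Hp p is 1 at 1 and 0 at p / (p - 1), so the intermediate value theorem puts
    y in the image of the interval on which omega inverts it. *)
Lemma omega_spec (y : R) : 0 <= y <= 1 ->
  1 <= omega p y /\ Hp p (omega p y) = y.
Proof.
move=> /andP[y0 y1]; pose b := p / (p - 1).
have b1 : 1 <= b by rewrite /b ler_pdivlMr// mul1r; lra.
have H1 : Hp p 1 = 1 by rewrite /Hp !powR1; lra.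
have Hb : Hp p b = 0.
  rewrite /Hp powR_split ?(le_trans ler01)// mulrA.
  have -> : - (p - 1) * b = - p by rewrite /b; field; rewrite gt_eqF.
  by rewrite mulNr addNr.
have cH : {within `[1, b], continuous (Hp p)}.
  apply: continuous_in_subspaceT => x; rewrite inE/= in_itv/= => /andP[x1 _].
  have x0 : 0 < x by rewrite (lt_le_trans ltr01).
  have cP r : {for x, continuous (fun z : R => z `^ r)}.
    exact: continuous_powR.
  by apply: cvgD; (apply: cvgM; first exact: cvg_cst); exact: cP.
have [|z zb Hz] := IVT (v := y) b1 cH.
  by rewrite H1 Hb minElt maxElt ltr10 y0 y1.
have imy : (Hp p @` `[1, b]) y by exists z.
split; last by rewrite /omega pinvK// inE.
have : `[1, b]%classic (omega p y).
  have surjH : set_surj `[1, b] (Hp p @` `[1, b]) (Hp p) by [].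
  by apply: (surjpinv_image_sub surjH); exists y.
by rewrite /= in_itv/= => /andP[].
Qed.

End young.

(** A bound of u by v with an arbitrarily small multiple of a fixed B as error
    is enough for convergence, because e is fixed before n: the constant K may
    blow up as e tends to 0. *)
Lemma cvg0_le_eps (R : realType) (B : R) (u v : nat -> R) :
  (forall n, 0 <= u n) -> 0 <= B ->
  (forall e : R, 0 < e -> exists2 K, 0 <= K &
    forall n, u n <= e * B + K * `|v n|) ->
  v @ \oo --> 0 -> u @ \oo --> 0.
Proof.
move=> u0 B0 uv /cvgrPdist_le v0; apply/cvgrPdist_le => eps eps0.
have B1 : 0 < B + 1 by rewrite ltr_wpDl.
have [|K K0 uK] := uv (eps / 2 / (B + 1)); first by rewrite !divr_gt0.
have K1 : 0 < K + 1 by rewrite ltr_wpDl.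
have d0 : 0 < eps / 2 / (K + 1) by rewrite !divr_gt0.
near=> n.
have : `|v n| <= eps / 2 / (K + 1).
  by rewrite -normrN -sub0r; near: n; exact: v0.
move=> vn; rewrite sub0r normrN ger0_norm//; apply: (le_trans (uK n)).
have h1 : eps / 2 / (B + 1) * B <= eps / 2.
  by rewrite -mulrA ler_piMr ?divr_ge0 ?(ltW eps0)// ler_pdivrMl// mulr1 lerDl.
have h2 : K * `|v n| <= eps / 2.
  apply: le_trans (_ : (K + 1) * (eps / 2 / (K + 1)) <= _).
    by apply: ler_pM => //; rewrite lerDl.
  by rewrite mulrC divfK// gt_eqF.
lra.
Unshelve. all: by end_near. Qed.

(** * The weak-type inequality for the maximal operator of a tree *)

Local Open Scope ereal_scope.

(** This brings the children of a tree element into the form required by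
    countable additivity; natural numbers that are not hit contribute the empty
    set. *)
Lemma countable_bigcup_nat (I X : Type) (D : set I) (F : I -> set X) :
  countable D ->
  exists G : nat -> set X,
    [/\ \bigcup_(i in D) F i = \bigcup_n G n,
        forall n, G n = set0 \/ exists2 i, D i & G n = F i &
        trivIset D F -> trivIset setT G].
Proof.
move=> /countable_injP[g ginj].
have gE i j : D i -> D j -> g i = g j -> i = j.
  by move=> Di Dj; apply: ginj; rewrite inE.
exists (fun n => \bigcup_(i in D `&` [set i | g i = n]) F i); split.
- apply/seteqP; split => x.
    by move=> [i Di Fix]; exists (g i) => //; exists i.
  by move=> [_ _ [i [Di _] Fix]]; exists i.
- move=> n; have [[i Di gin]|nex] := pselect (exists2 i, D i & g i = n).
    right; exists i => //; apply/seteqP; split => [x [j [Dj /= gj]]|x Fix].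
      by rewrite (gE j i) // gj.
    by exists i.
  left; apply/seteqP; split => // x [i [Di gin] _].
  by apply: nex; exists i.
- move=> tF n m _ _ [x [[i [Di <-] Fix] [j [Dj <-] Fjx]]].
  by congr (g _); apply: tF => //; exists x.
Qed.

Lemma countable_bigcup_measurable d (X : measurableType d) I
    (D : set I) (F : I -> set X) :
  countable D -> (forall i, D i -> measurable (F i)) ->
  measurable (\bigcup_(i in D) F i).
Proof.
move=> /(countable_bigcup_nat F)[G [-> GF _]] mF.
by apply: bigcupT_measurable => n; case: (GF n) => [->//|[i Di ->]]; exact: mF.
Qed.

Section weak_type.
Context d (X : measurableType d) (R : realType) (mu : probability X R).
Context (T : set (set X)) (C : set X -> set (set X)).
Hypothesis treeTC : is_tree_with mu T C.

Lemma generation_sub m : generation C m `<=` T.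
Proof.
by rewrite (tree_generations treeTC) => I; exists m.
Qed.

Lemma countable_tree : countable T.
Proof.
rewrite (tree_generations treeTC); apply: bigcup_countable => // m _.
elim: m => [|m IHm] /=; first exact: countable1.
apply: bigcup_countable => // I /generation_sub.
exact: (tree_child_countable treeTC).
Qed.

Context (psi : X -> R).
Hypothesis mpsi : measurable_fun setT psi.
Hypothesis psi0 : forall x, (0 <= psi x)%R.

Lemma maximal_ge0E x : maximal mu T psi x =
  ereal_sup [set Av mu I psi | I in [set I | T I /\ I x]].
Proof.
rewrite /maximal; congr ereal_sup; apply: eq_imagel => I _.
by congr Av; apply/funext => y; rewrite ger0_norm.
Qed.

Lemma superlevel_maximal (l : \bar R) :
  [set x | l < maximal mu T psi x] =
  \bigcup_(I in [set I | T I /\ l < Av mu I psi]) I.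
Proof.
apply/seteqP; split => x /=; rewrite maximal_ge0E.
  by move=> /ereal_sup_gtP[_ [I [TI Ix] <-] lI]; exists I.
move=> [I [TI lI] Ix]; apply/ereal_sup_gtP.
by exists (Av mu I psi) => //; exists I.
Qed.

Lemma measurable_superlevel (l : \bar R) :
  measurable [set x | l < maximal mu T psi x].
Proof.
rewrite superlevel_maximal; apply: countable_bigcup_measurable => [|I [TI _]].
  apply: (sub_countable _ countable_tree).
  by apply: subset_card_le => I [].
exact: (tree_measurable treeTC).
Qed.

Lemma measurable_maximal : measurable_fun setT (maximal mu T psi : X -> \bar R).
Proof.
move=> _; apply: (measurability _ (ErealGenOInfty.measurableE R)) => //.
move=> _ [_ [x ->] <-]; rewrite setTI.
rewrite (_ : _ @^-1` _ = [set y | x%:E < maximal mu T psi y]).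
  exact: measurable_superlevel.
by apply/seteqP; split => y /=; rewrite in_itv/= andbT.
Qed.

(** The part of the superlevel set of the maximal function at l witnessed by a
    descendant of I at most n generations below.  Stopping at the first
    element whose average exceeds l makes the union disjoint, so maximal tree
    elements never have to be selected. *)
Fixpoint exceed (l : R) (n : nat) (I : set X) : set X :=
  if l%:E < Av mu I psi then I
  else if n is n'.+1 then \bigcup_(J in C I) exceed l n' J else set0.

Lemma Av_gt_le (l : R) I : T I -> l%:E < Av mu I psi ->
  l%:E * mu I <= \int[mu]_(x in I) (psi x)%:E.
Proof.
move=> TI; rewrite /Av.
have muI0 := tree_pos treeTC TI.
have muIfin : mu I \is a fin_num.
  by apply: fin_num_measure; exact: (tree_measurable treeTC).
have r0 : (0 < fine (mu I))%R by rewrite fine_gt0// muI0 ltey_eq muIfin.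
have -> : (mu I)^-1 = ((fine (mu I))^-1)%:E.
  by rewrite -[in LHS](fineK muIfin) inver gt_eqF.
by rewrite lte_pdivlMl// fineK// muleC => /ltW.
Qed.

Lemma exceed_sub (l : R) n I : T I -> exceed l n I `<=` I.
Proof.
elim: n I => [|n IHn] I TI /=; case: ifPn => _ x //.
move=> [J CJ Jx]; rewrite (tree_child_cover treeTC TI); exists J => //.
by apply: IHn => //; exact: (tree_child_sub treeTC TI).
Qed.

Lemma exceed_weak_type (l : R) n I : (0 <= l)%R -> T I ->
  measurable (exceed l n I) /\
  l%:E * mu (exceed l n I) <= \int[mu]_(x in exceed l n I) (psi x)%:E.
Proof.
move=> l0; elim: n I => [|n IHn] I TI /=; case: ifPn => [lI|_].
- by split; [exact: (tree_measurable treeTC)|exact: Av_gt_le].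
- by split; [exact: measurable0|rewrite measure0 mule0 integral_set0].
- by split; [exact: (tree_measurable treeTC)|exact: Av_gt_le].
have TC J : C I J -> T J by exact: (tree_child_sub treeTC TI).
have [G [-> GE tG]] := countable_bigcup_nat (exceed l n)
  (tree_child_countable treeTC TI).
have GP k : measurable (G k) /\
    l%:E * mu (G k) <= \int[mu]_(x in G k) (psi x)%:E.
  case: (GE k) => [->|[J CJ ->]]; last exact/IHn/TC.
  by split; [exact: measurable0|rewrite measure0 mule0 integral_set0].
have {}tG : trivIset setT G.
  apply: tG => J K CJ CK [x [Jx Kx]].
  apply: (tree_child_disjoint treeTC TI) => //; exists x; split.
    exact: (exceed_sub (TC _ CJ) Jx).
  exact: (exceed_sub (TC _ CK) Kx).
have mG k := (GP k).1.
split; first exact: bigcupT_measurable.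
rewrite measure_semi_bigcup//; last exact: bigcupT_measurable.
rewrite ge0_integral_bigcup//; last 2 first.
- by apply/measurable_EFinP; exact: measurable_funTS.
- by move=> x _; rewrite lee_fin.
rewrite -nneseriesZl//; apply: lee_nneseries => k _.
  by rewrite mule_ge0.
exact: (GP k).2.
Qed.

(** Generations are built by adding children at the bottom while [exceed]
    descends from the top: membership is carried up the ancestors of I. *)
Lemma exceed_gen (l : R) n m I x : generation C m I ->
  exceed l n I x -> exceed l (n + m) setT x.
Proof.
elim: m n I => [|m IHm] n I /=; first by move=> ->; rewrite addn0.
move=> [J gJ CI] Ix; rewrite addnS -addSn; apply: (IHm _ J) => //=.
have TJ := generation_sub gJ.
case: ifPn => _; last by exists I.
rewrite (tree_child_cover treeTC TJ); exists I => //.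
exact: (exceed_sub (tree_child_sub treeTC TJ CI) Ix).
Qed.

Lemma bigcup_exceed (l : R) :
  \bigcup_n exceed l n setT = [set x | l%:E < maximal mu T psi x].
Proof.
rewrite superlevel_maximal; apply/seteqP; split => [x [n _]|x [I [TI lI] Ix]].
  move: (tree_setT treeTC); move: setT; elim: n => [|n IHn] I TI /=.
    by case: ifPn => // lI Ix; exists I.
  case: ifPn => [lI Ix|_ [J CJ Jx]]; first by exists I.
  exact: IHn (tree_child_sub treeTC TI CJ) Jx.
move: (TI); rewrite (tree_generations treeTC) => -[m _ gI].
exists m => //; rewrite -[m]add0n; apply: (exceed_gen gI).
by rewrite /= lI.
Qed.

Lemma exceed_homo (l : R) : nondecreasing_seq (fun n => exceed l n setT).
Proof.
apply/nondecreasing_seqP => n; apply/subsetPset; move: setT.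
elim: n => [|n IHn] I; first by rewrite /=; case: ifPn => _ x.
rewrite [X in X `<=` _]/= [X in _ `<=` X]/=.
by case: ifPn => _ x // [J CJ Jx]; exists J => //; exact: IHn.
Qed.

(** The bound holds for each depth-limited set, and these increase to the whole
    superlevel set. *)
Lemma maximal_weak_type (l : R) : (0 <= l)%R ->
  l%:E * mu [set x | l%:E < maximal mu T psi x] <=
  \int[mu]_(x in [set x | l%:E < maximal mu T psi x]) (psi x)%:E.
Proof.
move=> l0; have mex n := (exceed_weak_type n l0 (tree_setT treeTC)).1.
have : l%:E * mu (exceed l n setT) @[n --> \oo] -->
    l%:E * mu [set x | l%:E < maximal mu T psi x].
  apply: cvgeZl => //; rewrite -bigcup_exceed.
  by apply: nondecreasing_cvg_mu => //;
    [exact: bigcupT_measurable|exact: exceed_homo].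
move=> cvU; rewrite -(cvg_lim _ cvU)//; apply: lime_le; first exact: cvgP cvU.
apply: nearW => n.
apply: le_trans (exceed_weak_type n l0 (tree_setT treeTC)).2 _.
apply: ge0_subset_integral => //; first exact: measurable_superlevel.
- by apply/measurable_EFinP; exact: measurable_funTS.
- by move=> x _; rewrite lee_fin.
by rewrite -bigcup_exceed => x Ux; exists n.
Qed.

End weak_type.

(** * From the weak-type inequality to the sharp Doob-type inequality *)

Section weak_to_strong.
Context d (X : measurableType d) (R : realType) (mu : probability X R).
Context (p : R).
Hypothesis p_gt1 : (1 < p)%R.
Context (psi : X -> R) (M : X -> \bar R) (f : R).
Hypothesis mpsi : measurable_fun setT psi.
Hypothesis psi0 : forall x, (0 <= psi x)%R.
Hypothesis mM : measurable_fun setT M.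
Hypothesis f_gt0 : (0 < f)%R.
Hypothesis f_le_int : f%:E <= \int[mu]_x (psi x)%:E.
Hypothesis f_le_M : forall x, f%:E <= M x.
Definition above (l : R) : set X := [set x | l%:E < M x].

Hypothesis weak_type : forall l : R, (0 <= l)%R ->
  l%:E * mu (above l) <= \int[mu]_(x in above l) (psi x)%:E.

Let p_gt0 : (0 < p)%R. Proof. by rewrite (lt_trans _ p_gt1). Qed.
Let p1_gt0 : (0 < p - 1)%R. Proof. by rewrite subr_gt0. Qed.

Let measurable_lt l : measurable (above l).
Proof.
by rewrite -[X in measurable X]setTI; exact: emeasurable_fun_o_infty.
Qed.

Definition level (h : R) (i : nat) : R := (f + h * i%:R)%R.

(** M rounded down to the largest of the levels f, f + h, ..., f + h i strictly
    below it, and to f if there is none. *)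
Fixpoint stair (h : R) (i : nat) (x : X) : R :=
  if i is j.+1 then if (level h i)%:E < M x then level h i else stair h j x
  else f.

Section fixed_step.
Context (h : R).
Hypothesis h_gt0 : (0 < h)%R.

Lemma levelS i : level h i.+1 = (level h i + h)%R.
Proof. by rewrite /level -[in LHS]addn1 natrD mulrDr mulr1 addrA. Qed.

Lemma level_ge i : (f <= level h i)%R.
Proof. by rewrite lerDl mulr_ge0// ltW. Qed.

Lemma stair_below i x : (level h i.+1)%:E < M x -> stair h i x = level h i.
Proof.
case: i => [|i]; first by rewrite /= /level mulr0 addr0.
move=> lM; rewrite /= ifT//; apply: lt_trans lM.
by rewrite lte_fin [ltRHS]levelS ltrDl.
Qed.

(** A new level changes the value only where M exceeds it, and there the
    previous value is exactly the level below. *)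
Lemma stair_telescope (u : R -> R) i x :
  u (stair h i.+1 x) = (u (stair h i x) +
    (u (level h i.+1) - u (level h i)) * \1_(above (level h i.+1)) x)%R.
Proof.
have -> : \1_(above (level h i.+1)) x = ((level h i.+1)%:E < M x)%E%:R :> R.
  rewrite indicE; congr (_%:R)%R; congr nat_of_bool.
  by apply/idP/idP; rewrite inE.
rewrite /=; case: ifPn => lM; last by rewrite mulr0 addr0.
by rewrite stair_below// mulr1 subrKC.
Qed.

Lemma measurable_stair i : measurable_fun setT (stair h i).
Proof.
elim: i => [|i IHi]; first exact: measurable_cst.
apply: (eq_measurable_fun (fun x => stair h i x +
    (level h i.+1 - level h i) * \1_(above (level h i.+1)) x)%R).
  by move=> x _; rewrite (stair_telescope id).
apply: measurable_funD => //; apply: measurable_funM => //.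
Qed.

Lemma stair_ge i x : (f <= stair h i x)%R.
Proof.
by elim: i => [|i IHi]//=; case: ifPn => // _; exact: level_ge.
Qed.

Lemma stair_le_level i x : (stair h i x <= level h i)%R.
Proof.
elim: i => [|i IHi]; first exact: level_ge.
rewrite /=; case: ifPn => // _; apply: le_trans IHi _.
by rewrite levelS lerDl ltW.
Qed.

Lemma stair_le i x : (stair h i x)%:E <= M x.
Proof.
by elim: i => [|i IHi]//=; case: ifPn => // /ltW.
Qed.

Lemma stair_ge_sub i x (y : R) : M x = y%:E -> (y <= level h i.+1)%R ->
  (y - h <= stair h i x)%R.
Proof.
move=> Mxy; elim: i => [|i IHi].
  by rewrite levelS /level mulr0 addr0 -lerBlDr.
rewrite levelS -lerBlDr => yl; rewrite [stair _ _ _]/= Mxy lte_fin.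
by case: ltP.
Qed.

Lemma stair_infty i x : M x = +oo -> stair h i x = level h i.
Proof.
move=> My; case: i => [|i]; first by rewrite /= /level mulr0 addr0.
by rewrite /= My ltry.
Qed.

Let mpow r i : measurable_fun setT (fun x => stair h i x `^ r)%R.
Proof.
by apply: (measurableT_comp (measurable_powR r)); exact: measurable_stair.
Qed.

(** The sharp inequality for the rounded function, by induction on the number of
    levels.  A new level b above a adds (b^p - a^p) mu{M > b} to the integral on
    the left and (b^(p-1) - a^(p-1)) int_{M > b} psi to the one on the right;
    the weak-type bound at b and [powR_step] compare them. *)
Lemma stair_ineq i :
  (p - 1)%:E * \int[mu]_x (stair h i x `^ p)%:E + (f `^ p)%:E <=
  p%:E * \int[mu]_x (psi x * stair h i x `^ (p - 1))%:E.
Proof.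
elim: i => [|i IHi].
  rewrite [stair _ _]/= integral_cst//= probability_setT mule1.
  under eq_integral do rewrite mulrC EFinM.
  rewrite ge0_integralZl_EFin//; last 3 first.
  - by move=> x _; rewrite lee_fin.
  - exact/measurable_EFinP.
  - exact: powR_ge0.
  apply: le_trans (_ : p%:E * ((f `^ (p - 1))%:E * f%:E) <= _).
    rewrite -!EFinM -EFinD lee_fin (powR_split p_gt1) ?(ltW f_gt0)//; lra.
  rewrite !lee_pmul// ?lee_fin ?powR_ge0 ?(ltW p_gt0) ?(ltW f_gt0)//.
  by rewrite mulr_ge0 ?powR_ge0 ?(ltW f_gt0).
set a := level h i; set b := level h i.+1.
set A := above b.
have a0 : (0 <= a)%R by rewrite (le_trans _ (level_ge i))// ltW.
have ab : (a <= b)%R by rewrite /a /b levelS lerDl ltW.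
have b0 := le_trans a0 ab.
have mA : measurable A by exact: measurable_lt.
pose k r := (b `^ r - a `^ r)%R.
have k0 r : (0 < r)%R -> (0 <= k r)%R.
  by move=> r0; rewrite subr_ge0; exact: powR_le.
have -> : \int[mu]_x (stair h i.+1 x `^ p)%:E =
    \int[mu]_x (stair h i x `^ p)%:E + (k p)%:E * mu A.
  under eq_integral => x _ do
    rewrite (stair_telescope (fun z => z `^ p)%R) EFinD EFinM.
  rewrite ge0_integralD//=; last 4 first.
  - by move=> x _; rewrite lee_fin powR_ge0.
  - exact/measurable_EFinP.
  - by move=> x _; rewrite mule_ge0// lee_fin; exact: k0.
  - by apply: measurable_funeM; exact/measurable_EFinP.
  rewrite ge0_integralZl_EFin//; last 2 first.
  - exact/measurable_EFinP.
  - exact: k0.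
  by rewrite integral_indic// setIT.
have -> : \int[mu]_x (psi x * stair h i.+1 x `^ (p - 1))%:E =
    \int[mu]_x (psi x * stair h i x `^ (p - 1))%:E +
    (k (p - 1)%R)%:E * \int[mu]_(x in A) (psi x)%:E.
  under eq_integral => x _.
    rewrite (stair_telescope (fun z => z `^ (p - 1))%R) mulrDr EFinD mulrCA.
    rewrite [X in (_ + X)%E]EFinM.
    over.
  rewrite ge0_integralD//=; last 4 first.
  - by move=> x _; rewrite lee_fin mulr_ge0// powR_ge0.
  - by apply/measurable_EFinP; exact: measurable_funM.
  - by move=> x _; rewrite mule_ge0// lee_fin ?mulr_ge0//; exact: k0.
  - by apply: measurable_funeM; apply/measurable_EFinP; exact: measurable_funM.
  rewrite ge0_integralZl_EFin//; last 3 first.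
  - by move=> x _; rewrite lee_fin mulr_ge0.
  - by apply/measurable_EFinP; exact: measurable_funM.
  - exact: k0.
  congr (_ + _ * _); rewrite [RHS]integral_mkcond; apply: eq_integral => x _.
  by rewrite epatch_indic.
have step (S G m I : \bar R) : 0 <= S -> 0 <= G -> 0 <= m -> 0 <= I ->
    (p - 1)%:E * S + (f `^ p)%:E <= p%:E * G -> b%:E * m <= I ->
    (p - 1)%:E * (S + (k p)%:E * m) + (f `^ p)%:E <=
    p%:E * (G + (k (p - 1)%R)%:E * I).
  move=> S0 G0 m0 I0 SG mI.
  rewrite !ge0_muleDr ?mule_ge0 ?lee_fin ?k0// addeAC; apply: leeD => //.
  apply: le_trans (_ : p%:E * ((k (p - 1)%R)%:E * (b%:E * m)) <= _).
    rewrite !muleA; apply: lee_wpmul2r => //.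
    rewrite -!EFinM lee_fin; have := powR_step p_gt1 a0 b0.
    by rewrite /k -mulrA [in X in _ -> X](mulrC _ b).
  apply: lee_wpmul2l; first by rewrite lee_fin ltW.
  by apply: lee_wpmul2l => //; rewrite lee_fin k0.
apply: step IHi (weak_type b0) => //.
- by apply: integral_ge0 => x _; rewrite lee_fin powR_ge0.
- by apply: integral_ge0 => x _; rewrite lee_fin mulr_ge0// powR_ge0.
- by apply: integral_ge0 => x _; rewrite lee_fin.
Qed.

End fixed_step.

(** Mesh 1/(k+1) and (k+1)^2 levels: the mesh tends to 0 while the top level
    f + k + 1 tends to infinity. *)
Definition fine_stair (k : nat) : X -> R := stair k.+1%:R^-1 (k.+1 * k.+1).

Let mesh_gt0 k : (0 < k.+1%:R^-1 :> R)%R.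
Proof. by rewrite invr_gt0. Qed.

Let top_level k : level k.+1%:R^-1 (k.+1 * k.+1) = (f + k.+1%:R)%R.
Proof. by rewrite /level natrM mulKf. Qed.

Let measurable_fine_stair_powR k r :
  measurable_fun setT (fun x => fine_stair k x `^ r)%R.
Proof.
by apply: (measurableT_comp (measurable_powR r)); exact: measurable_stair.
Qed.

Let mMpow r : measurable_fun setT (fun x => M x `^ r).
Proof. exact: measurableT_comp (measurable_poweR r) mM. Qed.

Lemma fine_stair_powR_cvg x :
  (fine_stair k x `^ p)%:E @[k --> \oo] --> M x `^ p.
Proof.
move: (f_le_M x); case Mx: (M x) => [y| |] //= fy.
  have y0 : (0 < y)%R by rewrite (lt_le_trans f_gt0).
  apply: cvg_EFin; first exact: nearW.
  apply: (@cvg_comp _ _ _ (fun k => fine_stair k x) (fun z => z `^ p)%R _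
    (nbhs y)); last exact: continuous_powR.
  apply: (@squeeze_cvgr _ _ _ _ (fun k => y - k.+1%:R^-1)%R (cst y)).
  - near=> k; apply/andP; split.
      apply: (@stair_ge_sub _ _ _ _ Mx); rewrite levelS// top_level.
      rewrite -[leLHS]add0r -[leRHS]addrA lerD ?(ltW f_gt0)//.
      rewrite -[leLHS]addr0 lerD ?(ltW (mesh_gt0 k))//.
      apply: (@le_trans _ _ k%:R)%R; last by rewrite ler_nat.
      by near: k; exact: nbhs_infty_ger.
    by rewrite -lee_fin -Mx; exact: stair_le.
  - rewrite -[X in _ --> X]subr0; apply: cvgB; first exact: cvg_cst.
    exact: cvg_harmonic.
  - exact: cvg_cst.
rewrite gt_eqF//; apply/cvgeyPge => A; near=> k.
rewrite /fine_stair stair_infty// top_level lee_fin.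
have kA : (A <= k.+1%:R)%R.
  apply: (@le_trans _ _ k%:R)%R; last by rewrite ler_nat.
  by near: k; exact: nbhs_infty_ger.
apply: (le_trans kA).
apply: (@le_trans _ _ (k.+1%:R `^ p)%R).
  by apply: le1r_powR; rewrite ?ler1n// ltW.
by apply: powR_le => //; rewrite lerDr ltW.
Unshelve. all: by end_near. Qed.

(** Fatou's lemma along the stairs. *)
Lemma integral_pow_le (B : \bar R) :
  (forall k, \int[mu]_x (fine_stair k x `^ p)%:E <= B) ->
  \int[mu]_x (M x `^ p) <= B.
Proof.
move=> leB; pose g k x := (fine_stair k x `^ p)%:E.
have -> : \int[mu]_x (M x `^ p) = \int[mu]_x limn_einf (g^~ x).
  apply: eq_integral => x _; have cg := fine_stair_powR_cvg (x := x).
  by rewrite is_cvg_limn_einfE ?(cvg_lim _ cg)//; exact: cvgP cg.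
apply: le_trans (fatou _ _ _ _) _ => //.
- by move=> k; exact/measurable_EFinP.
- by move=> k x _; rewrite lee_fin powR_ge0.
rewrite limn_einf_lim; apply: lime_le; first exact: is_cvg_einfs.
apply: nearW => k; apply: le_trans (leB k).
by apply: ereal_inf_lbound; exists k => /=.
Qed.

(** The inequality for the stairs passes to the limit: on the right the stairs
    are below M, on the left [integral_pow_le] applies. *)
Lemma doob_inequality :
  (p - 1)%:E * \int[mu]_x (M x `^ p) + (f `^ p)%:E <=
  p%:E * \int[mu]_x ((psi x)%:E * M x `^ (p - 1)).
Proof.
have J0 : 0 <= \int[mu]_x ((psi x)%:E * M x `^ (p - 1)).
  by apply: integral_ge0 => x _; rewrite mule_ge0 ?lee_fin ?poweR_ge0.
have gridJ k : p%:E * \int[mu]_x (psi x * fine_stair k x `^ (p - 1))%:E <=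
    p%:E * \int[mu]_x ((psi x)%:E * M x `^ (p - 1)).
  apply: lee_wpmul2l; first by rewrite lee_fin ltW.
  apply: ge0_le_integral => //.
  - by move=> x _; rewrite lee_fin mulr_ge0// powR_ge0.
  - by apply/measurable_EFinP; exact: measurable_funM.
  - by apply: emeasurable_funM => //; exact/measurable_EFinP.
  move=> x _; rewrite EFinM lee_wpmul2l ?lee_fin// -poweR_EFin.
  have M0 : 0 <= M x by apply: le_trans (f_le_M x); rewrite lee_fin ltW.
  apply: gt0_ler_poweR; last exact: stair_le.
  - exact: ltW.
  - by rewrite in_itv/= lee_fin leey (le_trans (ltW f_gt0))// stair_ge.
  - by rewrite in_itv/= M0 leey.
have gineq k : (p - 1)%:E * \int[mu]_x (fine_stair k x `^ p)%:E + (f `^ p)%:E <=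
    p%:E * \int[mu]_x ((psi x)%:E * M x `^ (p - 1)).
  by apply: le_trans (gridJ k); exact: stair_ineq.
move: J0 gineq.
case: (\int[mu]_x ((psi x)%:E * M x `^ (p - 1))) => [j| |] // J0.
  rewrite -EFinM => gineq.
  have : \int[mu]_x (M x `^ p) <= ((p - 1)^-1)%:E * (p * j - f `^ p)%:E.
    apply: integral_pow_le => k.
    by rewrite lee_pdivlMl// [(p * j - _)%:E]EFinB leeBrDr.
  by rewrite lee_pdivlMl// [(p * j - _)%:E]EFinB leeBrDr.
by rewrite gt0_muley ?lte_fin// leey.
Qed.

(** Young's inequality for (2 psi, stair) turns the cross term of [stair_ineq]
    into half of the left-hand side plus a multiple of F.  The integral of the
    p-th power of a stair is finite because stairs are bounded, so it can be
    absorbed. *)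
Lemma integral_pow_bound (F : R) : \int[mu]_x (psi x `^ p)%:E = F%:E ->
  \int[mu]_x (M x `^ p) <= (2 `^ p * F / (p - 1))%:E.
Proof.
move=> psiF; apply: integral_pow_le => k.
pose S := \int[mu]_x (fine_stair k x `^ p)%:E.
pose J := \int[mu]_x (psi x * fine_stair k x `^ (p - 1))%:E.
have g0 x : (0 <= fine_stair k x)%R.
  by rewrite (le_trans (ltW f_gt0))// stair_ge.
have S0 : 0 <= S by apply: integral_ge0 => x _; rewrite lee_fin powR_ge0.
have J0 : 0 <= J.
  by apply: integral_ge0 => x _; rewrite lee_fin mulr_ge0// powR_ge0.
have Sfin : S \is a fin_num.
  rewrite ge0_fin_numE//.
  apply: (@le_lt_trans _ _ ((f + k.+1%:R) `^ p)%:E); last exact: ltry.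
  rewrite -[leRHS]mule1 -(probability_setT mu) -integral_cst//.
  apply: ge0_le_integral => //.
  - by move=> x _; rewrite lee_fin powR_ge0.
  - exact/measurable_EFinP.
  - by move=> x _; rewrite lee_fin powR_le// -top_level stair_le_level.
have gineq : (p - 1)%:E * S + (f `^ p)%:E <= p%:E * J by exact: stair_ineq.
have youngJ : (2 * p)%:E * J <= (2 `^ p * F)%:E + (p - 1)%:E * S.
  rewrite [(2 `^ p * F)%:E]EFinM -psiF.
  rewrite -(ge0_integralZl_EFin _ _ _ _ (powR_ge0 2 p))//; last 2 first.
  - by move=> x _; rewrite lee_fin powR_ge0.
  - by apply/measurable_EFinP; exact: (measurableT_comp (measurable_powR p)).
  rewrite -(ge0_integralZl_EFin _ _ _ _ (ltW p1_gt0))//; last 2 first.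
  - by move=> x _; rewrite lee_fin powR_ge0.
  - exact/measurable_EFinP.
  rewrite -ge0_integralZl_EFin//; last 3 first.
  - by move=> x _; rewrite lee_fin mulr_ge0// powR_ge0.
  - by apply/measurable_EFinP; exact: measurable_funM.
  - by rewrite mulr_ge0// ltW.
  rewrite -ge0_integralD//; last 4 first.
  - by move=> x _; rewrite lee_fin mulr_ge0// powR_ge0.
  - apply: measurable_funeM; apply/measurable_EFinP.
    exact: (measurableT_comp (measurable_powR p)).
  - by move=> x _; rewrite lee_fin mulr_ge0 ?powR_ge0// ltW.
  - by apply: measurable_funeM; exact/measurable_EFinP.
  apply: ge0_le_integral => //.
  - move=> x _; rewrite lee_fin mulr_ge0// ?mulr_ge0 ?powR_ge0//.
    exact: ltW.
  - by apply: measurable_funeM; apply/measurable_EFinP; exact: measurable_funM.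
  - apply: emeasurable_funD;
      apply: measurable_funeM; apply/measurable_EFinP => //.
    exact: (measurableT_comp (measurable_powR p)).
  move=> x _; rewrite -!EFinM -EFinD lee_fin.
  have := young_gap_ge0 p_gt1 (mulr_ge0 (ler0n R 2) (psi0 x)) (g0 x).
  by rewrite /young_gap powRM//; lra.
rewrite -/S.
move: (S) Sfin (J) J0 gineq youngJ => [s| |]// _ [j| |]// _; last first.
  by move=> _; rewrite gt0_muley ?lte_fin ?mulr_gt0// -EFinM -EFinD leye_eq.
rewrite -!EFinM -!EFinD !lee_fin ler_pdivlMr// => gineq youngJ.
have := powR_ge0 f p; lra.
Qed.

End weak_to_strong.

(** * Comparison of M and c phi *)

Section lincomb.
Context d (X : measurableType d) (R : realType).
Context (mu : {measure set X -> \bar R}).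

Lemma ge0_integral_lincomb (u1 u2 : X -> R) (k1 k2 : R) :
  measurable_fun setT u1 -> measurable_fun setT u2 ->
  (forall x, 0 <= u1 x)%R -> (forall x, 0 <= u2 x)%R ->
  (0 <= k1)%R -> (0 <= k2)%R ->
  \int[mu]_x (k1 * u1 x + k2 * u2 x)%:E =
  k1%:E * \int[mu]_x (u1 x)%:E + k2%:E * \int[mu]_x (u2 x)%:E.
Proof.
move=> mu1 mu2 u10 u20 k10 k20.
under eq_integral do rewrite EFinD !EFinM.
rewrite ge0_integralD//; last 4 first.
- by move=> x _; rewrite lee_fin mulr_ge0.
- by apply: measurable_funeM; exact/measurable_EFinP.
- by move=> x _; rewrite lee_fin mulr_ge0.
- by apply: measurable_funeM; exact/measurable_EFinP.
rewrite !ge0_integralZl_EFin//.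
- by move=> x _; rewrite lee_fin.
- exact/measurable_EFinP.
- by move=> x _; rewrite lee_fin.
- exact/measurable_EFinP.
Qed.

Lemma ge0_le_integral_lincomb (u1 u2 u3 u4 : X -> R) (k1 k2 k3 k4 : R) :
  measurable_fun setT u1 -> measurable_fun setT u2 ->
  measurable_fun setT u3 -> measurable_fun setT u4 ->
  (forall x, 0 <= u1 x)%R -> (forall x, 0 <= u2 x)%R ->
  (forall x, 0 <= u3 x)%R -> (forall x, 0 <= u4 x)%R ->
  (0 <= k1)%R -> (0 <= k2)%R -> (0 <= k3)%R -> (0 <= k4)%R ->
  (forall x, k1 * u1 x + k2 * u2 x <= k3 * u3 x + k4 * u4 x)%R ->
  k1%:E * \int[mu]_x (u1 x)%:E + k2%:E * \int[mu]_x (u2 x)%:E <=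
  k3%:E * \int[mu]_x (u3 x)%:E + k4%:E * \int[mu]_x (u4 x)%:E.
Proof.
move=> mu1 mu2 mu3 mu4 u10 u20 u30 u40 k10 k20 k30 k40 le.
rewrite -!ge0_integral_lincomb//; apply: ge0_le_integral => //.
- by move=> x _; rewrite lee_fin addr_ge0// mulr_ge0.
- by apply/measurable_EFinP; apply: measurable_funD; exact: measurable_funM.
- by apply/measurable_EFinP; apply: measurable_funD; exact: measurable_funM.
- by move=> x _; rewrite lee_fin.
Qed.
End lincomb.

Section stability.
Context d (X : measurableType d) (R : realType).
Context (mu : {measure set X -> \bar R}).
Context (p : R) (p_gt1 : (1 < p)%R) (psi : X -> R) (M : X -> \bar R).
Context (f F S c : R).
Hypothesis mpsi : measurable_fun setT psi.
Hypothesis psi0 : forall x, (0 <= psi x)%R.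
Hypothesis mM : measurable_fun setT M.
Hypothesis M0 : forall x, 0 <= M x.
Hypothesis psiF : \int[mu]_x (psi x `^ p)%:E = F%:E.
Hypothesis MS : \int[mu]_x (M x `^ p) = S%:E.
Hypothesis c0 : (0 <= c)%R.

Let p_gt0 : (0 < p)%R. Proof. by rewrite (lt_trans _ p_gt1). Qed.
Let p1_gt0 : (0 < p - 1)%R. Proof. by rewrite subr_gt0. Qed.
Let G x := fine (M x).
Let G0 x : (0 <= G x)%R. Proof. exact: fine_ge0. Qed.
Let mG : measurable_fun setT G. Proof. exact: measurableT_comp. Qed.
Let mpow r (g : X -> R) : measurable_fun setT g ->
  measurable_fun setT (fun x => g x `^ r)%R.
Proof. by move=> mg; apply: (measurableT_comp (measurable_powR r)). Qed.

Let M_fin : {ae mu, forall x, M x \is a fin_num}.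
Proof.
have iM : mu.-integrable setT (fun x => M x `^ p).
  apply/integrableP; split.
    exact: measurableT_comp (measurable_poweR p) mM.
  under eq_integral do rewrite gee0_abs ?poweR_ge0//.
  by rewrite MS ltry.
have := integrable_ae measurableT iM; apply: filterS => x /(_ Logic.I).
rewrite ge0_fin_numE ?poweR_ge0// => /lty_poweRy Mx.
by rewrite ge0_fin_numE// Mx// gt_eqF.
Qed.

(** M is finite almost everywhere, so it can be replaced by the real-valued
    function G under the integral sign. *)
Let int_fine (u : \bar R -> X -> \bar R) :
  measurable_fun setT (fun x => u (M x) x) ->
  measurable_fun setT (fun x => u (G x)%:E x) ->
  (forall y x, 0 <= y -> 0 <= u y x) ->
  \int[mu]_x u (M x) x = \int[mu]_x u (G x)%:E x.
Proof.
move=> m1 m2 u0; apply: ge0_ae_eq_integral => //.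
- by move=> x _; exact: u0.
- by move=> x _; apply: u0; rewrite lee_fin.
- by apply: filterS M_fin => x Mx _; rewrite /G fineK.
Qed.

Let int_powE : \int[mu]_x (G x `^ p)%:E = S%:E.
Proof.
rewrite -MS; symmetry; apply: (int_fine (u := fun y _ => y `^ p)).
- exact: measurableT_comp (measurable_poweR p) mM.
- by apply/measurable_EFinP; exact: mpow.
- by move=> y _ _; exact: poweR_ge0.
Qed.

Let int_crossE : \int[mu]_x ((psi x)%:E * M x `^ (p - 1)) =
  \int[mu]_x (psi x * G x `^ (p - 1))%:E.
Proof.
apply: (int_fine (u := fun y x => (psi x)%:E * y `^ (p - 1))).
- apply: emeasurable_funM; first exact/measurable_EFinP.
  exact: measurableT_comp (measurable_poweR _) mM.
- by apply/measurable_EFinP; apply: measurable_funM => //; exact: mpow.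
- by move=> y x _; rewrite mule_ge0 ?lee_fin ?poweR_ge0.
Qed.

Let mcpsi : measurable_fun setT (fun x => c * psi x)%R.
Proof. exact: measurable_funM. Qed.

Let mdist : measurable_fun setT (fun x => `|c * psi x - G x| `^ p)%R.
Proof.
by apply: mpow; apply: measurableT_comp => //; exact: measurable_funB.
Qed.

Lemma int_distE : \int[mu]_x (`| M x - (c * psi x)%:E | `^ p) =
  \int[mu]_x (`|c * psi x - G x| `^ p)%:E.
Proof.
rewrite (int_fine (u := fun y x => `| y - (c * psi x)%:E | `^ p)).
- by apply: eq_integral => x _; rewrite distrC.
- apply: measurableT_comp (measurable_poweR p) _.
  apply: measurableT_comp => //; apply: emeasurable_funB => //.
  exact/measurable_EFinP.
- apply/measurable_EFinP; apply: mpow; apply: measurableT_comp => //.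
  exact: measurable_funB.
- by move=> y x _; exact: poweR_ge0.
Qed.

Let int_cpsiE : \int[mu]_x ((c * psi x) `^ p)%:E = (c `^ p * F)%:E.
Proof.
under eq_integral => x _ do rewrite powRM// EFinM.
rewrite ge0_integralZl_EFin ?psiF ?powR_ge0//.
- by move=> x _; rewrite lee_fin powR_ge0.
- by apply/measurable_EFinP; exact: mpow.
Qed.

(** Integrated form of a bound of the distance by the Young gap of (c psi, M),
    with the cross term of the gap eliminated by means of the Doob-type
    inequality. *)
Lemma integral_dist_le (e K : R) : (0 <= e)%R -> (0 <= K)%R ->
  (forall a b : R, (0 <= a)%R -> (0 <= b)%R ->
    (`|a - b| `^ p <= e * (a `^ p + b `^ p) + K * young_gap p a b)%R) ->
  (p - 1)%:E * S%:E + (f `^ p)%:E <=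
    p%:E * \int[mu]_x ((psi x)%:E * M x `^ (p - 1)) ->
  \int[mu]_x (`| M x - (c * psi x)%:E | `^ p) <=
  (e * (c `^ p * F + S) +
   K * (c `^ p * F + (p - 1) * S - c * ((p - 1) * S + f `^ p)))%:E.
Proof.
move=> e0 K0 gap; rewrite int_distE int_crossE => doob.
have := @ge0_le_integral_lincomb _ _ _ mu
  (fun x => `|c * psi x - G x| `^ p)%R (fun x => psi x * G x `^ (p - 1))%R
  (fun x => (c * psi x) `^ p)%R (fun x => G x `^ p)%R
  1 (K * c * p) (e + K) (e + K * (p - 1)).
rewrite mul1e int_powE int_cpsiE => main.
set I := \int[mu]_x (`|c * psi x - G x| `^ p)%:E in main *.
set J := \int[mu]_x (psi x * G x `^ (p - 1))%:E in main doob.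
have {}main : I + (K * c)%:E * (p%:E * J) <=
    ((e + K) * (c `^ p * F) + (e + K * (p - 1)) * S)%:E.
  rewrite muleA -EFinM EFinD 2![in leRHS]EFinM; apply: main => //.
  - by apply: measurable_funM => //; exact: mpow.
  - exact: mpow.
  - exact: mpow.
  - by move=> x; rewrite mulr_ge0 ?powR_ge0.
  - by move=> x; exact: powR_ge0.
  - by move=> x; exact: powR_ge0.
  - by rewrite !mulr_ge0// ltW.
  - by rewrite addr_ge0.
  - by rewrite addr_ge0// mulr_ge0// ltW.
  - move=> x; have := gap _ _ (mulr_ge0 c0 (psi0 x)) (G0 x).
    by rewrite /young_gap; lra.
have Kc : 0 <= (K * c)%:E by rewrite lee_fin mulr_ge0.
have {}doob := lee_wpmul2l Kc doob.
have {}main := le_trans (leeD2l I doob) main.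
have lhsE : (K * c)%:E * ((p - 1)%:E * S%:E + (f `^ p)%:E) =
  (K * c * ((p - 1) * S + f `^ p))%:E by [].
move: main; rewrite lhsE -leeBrDr// -EFinB => main.
by apply: le_trans main _; rewrite lee_fin; lra.
Qed.

Lemma integral_pow_close (e K : R) : (0 < e < 1)%R -> (0 <= K)%R ->
  (forall a b : R, (0 <= a)%R -> (0 <= b)%R ->
    (b `^ p <= a `^ p + e * b `^ p + K * `|a - b| `^ p)%R) ->
  forall i : R, \int[mu]_x (`| M x - (c * psi x)%:E | `^ p) = i%:E ->
  ((1 - e) * S <= c `^ p * F + K * i /\
   (1 - e) * (c `^ p * F) <= S + K * i)%R.
Proof.
move=> /andP[e0 e1] K0 le i; rewrite int_distE => iE.
have e10 : (0 <= 1 - e)%R by rewrite subr_ge0 ltW.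
split; rewrite -lee_fin.
  have := @ge0_le_integral_lincomb _ _ _ mu
    (fun x => G x `^ p)%R (fun x => G x `^ p)%R
    (fun x => (c * psi x) `^ p)%R (fun x => `|c * psi x - G x| `^ p)%R
    (1 - e) 0 1 K.
  rewrite mul1e mul0e adde0 int_powE int_cpsiE iE -!EFinM -EFinD; apply => //.
  - exact: mpow.
  - exact: mpow.
  - exact: mpow.
  - by move=> x; exact: powR_ge0.
  - by move=> x; exact: powR_ge0.
  - by move=> x; exact: powR_ge0.
  - by move=> x; have := le _ _ (mulr_ge0 c0 (psi0 x)) (G0 x); lra.
have := @ge0_le_integral_lincomb _ _ _ mu
  (fun x => (c * psi x) `^ p)%R (fun x => G x `^ p)%R
  (fun x => G x `^ p)%R (fun x => `|c * psi x - G x| `^ p)%R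
  (1 - e) 0 1 K.
rewrite mul1e mul0e adde0 int_powE int_cpsiE iE -!EFinM -EFinD; apply => //.
- exact: mpow.
- exact: mpow.
- exact: mpow.
- by move=> x; exact: powR_ge0.
- by move=> x; exact: powR_ge0.
- by move=> x; exact: powR_ge0.
- move=> x; have := le _ _ (G0 x) (mulr_ge0 c0 (psi0 x)).
  by rewrite distrC; lra.
Qed.

End stability.

Theorem theoremA (d : measure_display) (X : measurableType d) (R : realType)
    (mu : probability X R) (T : set (set X)) (p f F : R)
    (phi : nat -> X -> R)
    (mu_nonatomic : nonatomic mu)
    (T_tree : is_tree mu T)
    (p_gt1 : (1 < p)%R)
    (f_gt0 : (0 < f)%R)
    (fp_le_F : (f `^ p <= F)%R)
    (phi_integrable : forall n, mu.-integrable setT (EFin \o phi n))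
    (phi_ge0 : forall n x, (0 <= phi n x)%R)
    (phi_good : forall n, good mu T (phi n))
    (phi_mean : forall n, \int[mu]_x (phi n x)%:E = f%:E)
    (phi_pow : forall n, \int[mu]_x (phi n x `^ p)%:E = F%:E) :
  extremal mu T p f F phi <->
  \int[mu]_x (`| maximal mu T (phi n) x
                 - (omega p (f `^ p / F) * phi n x)%:E | `^ p) @[n --> \oo]
    --> 0.
Proof.
have [C treeTC] := T_tree.
have p_gt0 : (0 < p)%R by rewrite (lt_trans _ p_gt1).
have p1_gt0 : (0 < p - 1)%R by rewrite subr_gt0.
have F_gt0 : (0 < F)%R by rewrite (lt_le_trans _ fp_le_F)// powR_gt0.
have y01 : (0 <= f `^ p / F <= 1)%R.
  by rewrite divr_ge0 ?powR_ge0 ?(ltW F_gt0)//= ler_pdivrMr// mul1r.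
have [c1 Hc] := omega_spec p_gt1 y01.
rewrite /extremal; move: (omega p _) c1 Hc => c c1 Hc.
have c0 : (0 <= c)%R by rewrite (le_trans ler01).
pose A := (c `^ p * F)%R; pose B := (2 `^ p * F / (p - 1))%R.
have A0 : (0 <= A)%R by rewrite mulr_ge0 ?powR_ge0// ltW.
have B0 : (0 <= B)%R by rewrite divr_ge0 ?mulr_ge0 ?powR_ge0 ?(ltW F_gt0)// ltW.
(* the equation defining c, in the form in which it cancels the terms
   other than A - S n in [integral_dist_le] *)
have AE : (A - c * f `^ p = (p - 1) * (c - 1) * A)%R.
  have : (f `^ p = F * Hp p c)%R by rewrite Hc mulrC divfK// gt_eqF.
  by rewrite /A /Hp (powR_split p_gt1 c0) => ->; ring.
have mphi n : measurable_fun setT (phi n).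
  exact/measurable_EFinP/(measurable_int _ (phi_integrable n)).
have mM n : measurable_fun setT (maximal mu T (phi n) : X -> \bar R).
  refine (measurable_maximal treeTC (phi_ge0 n)).
have f_le_M n x : f%:E <= maximal mu T (phi n) x.
  rewrite (maximal_ge0E _ _ (phi_ge0 n)); apply: ereal_sup_ubound.
  exists setT; first by split => //; exact: tree_setT treeTC.
  by rewrite /Av/= probability_setT inve1 mul1e phi_mean.
have M0 n x : 0 <= maximal mu T (phi n) x.
  by apply: le_trans (f_le_M n x); rewrite lee_fin ltW.
have f_le_int n : f%:E <= \int[mu]_x (phi n x)%:E by rewrite phi_mean.
have weak n := maximal_weak_type treeTC (mphi n) (phi_ge0 n).
have doob n := doob_inequality p_gt1 (mphi n) (phi_ge0 n) (mM n) f_gt0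
  (f_le_int n) (f_le_M n) (@weak n).
have leB n := integral_pow_bound p_gt1 (mphi n) (phi_ge0 n) (mM n) f_gt0
  (f_le_int n) (f_le_M n) (@weak n) (phi_pow n).
pose S n := fine (\int[mu]_x (maximal mu T (phi n) x `^ p)).
have SE n : \int[mu]_x (maximal mu T (phi n) x `^ p) = (S n)%:E.
  rewrite fineK// ge0_fin_numE; first by rewrite (le_lt_trans (leB n))// ltry.
  by apply: integral_ge0 => x _; exact: poweR_ge0.
have S0 n : (0 <= S n)%R.
  by apply: fine_ge0; apply: integral_ge0 => x _; exact: poweR_ge0.
have SB n : (S n <= B)%R by rewrite -lee_fin -SE.
pose D n := \int[mu]_x (`| maximal mu T (phi n) x - (c * phi n x)%:E | `^ p).
have D0 n : 0 <= D n by apply: integral_ge0 => x _; exact: poweR_ge0.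
have D_le e : (0 < e)%R -> exists2 K, (0 <= K)%R & forall n,
    D n <= (e * (A + B) + K * `|S n - A|)%:E.
  move=> e0; have [K K0 gap] := powR_dist_le_gap p_gt1 e0.
  exists (K * ((p - 1) * (c - 1)))%R => [|n].
    by rewrite !mulr_ge0 ?subr_ge0// ltW.
  have := doob n; rewrite SE => doobn.
  apply: le_trans (integral_dist_le p_gt1 (mphi n) (phi_ge0 n) (mM n) (M0 n)
    (phi_pow n) (SE n) c0 (ltW e0) K0 gap doobn) _.
  rewrite -/A lee_fin; apply: lerD; first by rewrite ler_pM2l// lerD2l.
  rewrite -mulrA ler_wpM2l//.
  have -> : (A + (p - 1) * S n - c * ((p - 1) * S n + f `^ p) =
      (p - 1) * (c - 1) * (A - S n))%R by rewrite mulrBr -AE; ring.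
  rewrite ler_wpM2l ?mulr_ge0 ?subr_ge0 ?(ltW p_gt1)//.
  by rewrite distrC ler_norm.
pose i n := fine (D n).
have DE n : D n = (i n)%:E.
  rewrite fineK// ge0_fin_numE//.
  by have [K K0 /(_ n)/le_lt_trans->//] := D_le _ ltr01; rewrite ltry.
have i0 n : (0 <= i n)%R by exact: fine_ge0.
have DiE : (fun n => \int[mu]_x
    (`| maximal mu T (phi n) x - (c * phi n x)%:E | `^ p)) = EFin \o i.
  exact/funext.
have SiE : (fun n => \int[mu]_x (maximal mu T (phi n) x `^ p)) = EFin \o S.
  exact/funext.
have cvgE (u : nat -> R) (l : R) :
    (EFin \o u @ \oo --> l%:E) <-> (u @ \oo --> l)%R.
  split; first by move/fine_cvgP => [].
  by move=> ul; apply: cvg_EFin => //; exact: nearW.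
rewrite SiE DiE mulrC -/A !cvgE; split => [SA|i_0].
  apply: (@cvg0_le_eps _ (A + B) _ (fun n => S n - A)%R) => //.
  - exact: addr_ge0.
  - move=> e /D_le[K K0 DK]; exists K => // n.
    by rewrite -lee_fin -DE.
  - by rewrite -(subrr A); apply: cvgB => //; exact: cvg_cst.
have SA0 : (fun n => `|S n - A|)%R @ \oo --> (0 : R)%R.
  apply: (@cvg0_le_eps _ (A + B) _ i) => //; first exact: addr_ge0.
  (* [powR_le_dist] is used with a parameter below 1 *)
  move=> e e0; pose t := Num.min e (1 / 2)%R.
  have t0 : (0 < t)%R by rewrite lt_min e0 divr_gt0.
  have te : (t <= e)%R by rewrite ge_min lexx.
  have t1 : (t < 1)%R by rewrite gt_min; apply/orP; right; lra.
  have [K K0 le] := powR_le_dist p_gt1 t0; exists K => // n.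
  have t01 : (0 < t < 1)%R by rewrite t0 t1.
  have [] := integral_pow_close p_gt1 (mphi n) (phi_ge0 n) (mM n) (M0 n)
    (phi_pow n) (SE n) c0 t01 K0 le (DE n).
  rewrite -/A (ger0_norm (i0 n)) ler_norml => h1 h2.
  have tAB : (t * (A + B) <= e * (A + B))%R by rewrite ler_wpM2r// addr_ge0.
  have tA : (0 <= t * A)%R by rewrite mulr_ge0// ltW.
  have tSB : (t * S n <= t * B)%R by rewrite ler_pM2l.
  have tB : (0 <= t * B)%R by rewrite mulr_ge0// ltW.
  by apply/andP; split; lra.
apply/cvgrPdist_le => e e0.
move/cvgrPdist_le : SA0 => /(_ e e0); apply: filterS => n.
by rewrite sub0r normrN normr_id distrC.
Qed.
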